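(* Let $q$ be a complex number with $q\neq 0,1$, let $m,r$ be complex numbers, and write $[i]_q=\frac{q^i-1}{q-1}$. For all integers $0\le k\le n$, the $(q,r)$-Whitney numbers of the first kind satisfy $$w_{m,r,q}(n,k)=(-1)^{n-k}q^{-\binom{n}{2}}\sum_{0\leq i_1<i_2<\cdots<i_{n-k}\leq n-1}\ \prod_{j=1}^{n-k}\big(r+[i_j]_q\,m\big).$$
   Context: The $(q,r)$-Whitney numbers of the first kind $w_{m,r,q}(n,k)$ are defined as the coefficients in $m^n(a^\dagger)^n a^n=\sum_{k=0}^{n}w_{m,r,q}(n,k)(ma^\dagger a+r)^k$, where $a^\dagger,a$ are $q$-boson operators satisfying $aa^\dagger-qa^\dagger a=1$. Equivalently, they are the unique numbers with $w_{m,r,q}(0,0)=1$, $w_{m,r,q}(n,k)=0$ for $k<0$ or $k>n$, and the recurrence $w_{m,r,q}(n+1,k)=q^{-n}\big(w_{m,r,q}(n,k-1)-(m[n]_q+r)w_{m,r,q}(n,k)\big)$ for $n\ge 0$. An empty sum-over-products (when $n=k$) has the single empty product equal to $1$. *)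

(* Defs.v *)
From HB Require Import structures.
From mathcomp Require Import all_boot all_order all_algebra.
From mathcomp Require Import ring.

Set Implicit Arguments.
Unset Strict Implicit.
Unset Printing Implicit Defensive.

Import GRing.Theory.
Local Open Scope ring_scope.

Definition qint (F : fieldType) (q : F) (i : nat) : F := (q ^+ i - 1) / (q - 1).

(* Defined by the recurrence, with w(n, -1) = 0 at k = 0, because the numbers
   are then determined for m = 0 as well; normal_order_coefsP below shows that
   for m != 0 they are exactly the normal ordering coefficients. *)
Fixpoint qr_whitney1 (F : fieldType) (q m r : F) (n k : nat) : F :=
  match n with
  | 0 => (k == 0%N)%:R
  | n'.+1 =>
      q ^- n' * ((if k is k'.+1 then qr_whitney1 q m r n' k' else 0)
                 - (m * qint q n' + r) * qr_whitney1 q m r n' k)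
  end.

Definition qboson (F : fieldType) (A : algType F) (q : F) (a ad : A) : Prop :=
  a * ad - q *: (ad * a) = 1.

(* An identity in the algebra presented by the single relation qboson is the
   same thing as an identity holding for all q-boson pairs in all algebras. *)
Definition normal_order_coefs (F : fieldType) (q m r : F) (n : nat)
    (c : nat -> F) : Prop :=
  forall (A : algType F) (a ad : A), qboson q a ad ->
    m ^+ n *: (ad ^+ n * a ^+ n)
      = \sum_(k < n.+1) c k *: (m *: (ad * a) + r%:A) ^+ k.

Lemma qr_whitney1_gt (F : fieldType) (q m r : F) (n k : nat) :
  (n < k)%N -> qr_whitney1 q m r n k = 0.
Proof.
elim: n k => [|n IHn] [|k] //= ltnk.
by rewrite !IHn ?mulr0 ?subrr ?mulr0 // ltnW.
Qed.

Lemma qboson_shift (F : fieldType) (q : F) (A : algType F) (a ad : A)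
    (n : nat) :
  q != 1 -> qboson q a ad ->
  a ^+ n * (ad * a) = q ^+ n *: (ad * a ^+ n.+1) + qint q n *: a ^+ n.
Proof.
move=> q1 /eqP; rewrite subr_eq => /eqP aad.
have q10 : q - 1 != 0 by rewrite subr_eq0.
elim: n => [|n IHn].
  by rewrite !expr0 mul1r scale1r expr1 /qint expr0 subrr mul0r scale0r addr0.
rewrite exprS -mulrA IHn mulrDr -!scalerAr mulrA aad mulrDl mul1r scalerDr.
rewrite -!scalerAl scalerA -exprSr -mulrA -!exprS.
rewrite addrAC -scalerDl addrC; congr (_ + _ *: _).
by rewrite /qint exprS; field.
Qed.

Lemma qr_whitney1_normal_order (F : fieldType) (q m r : F) (n : nat) :
  q != 0 -> q != 1 -> normal_order_coefs q m r n (qr_whitney1 q m r n).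
Proof.
move=> q0 q1 A a ad qb; set X := m *: (ad * a) + r%:A.
have qn0 i : q ^+ i != 0 by rewrite expf_neq0.
elim: n => [|n IHn]; first by rewrite big_ord1 !expr0 mulr1 !scale1r.
have step : m ^+ n.+1 *: (ad ^+ n.+1 * a ^+ n.+1)
    = q ^- n *: ((m ^+ n *: (ad ^+ n * a ^+ n)) * (X - (m * qint q n + r)%:A)).
  have -> : X - (m * qint q n + r)%:A = m *: (ad * a - qint q n *: 1).
    by rewrite /X scalerBr scalerA scalerDl opprD addrACA subrr addr0.
  rewrite -scalerAr -scalerAl -mulrA mulrBr (qboson_shift n q1 qb).
  rewrite -scalerAr mulr1 addrK -scalerAr mulrA -exprSr !scalerA.
  by congr (_ *: _); rewrite exprS; field; rewrite qn0.
rewrite step IHn mulrBr mulr_suml -scalerAr mulr1 scaler_sumr.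
rewrite [in RHS]big_ord_recl.
under [X in _ = _ + X]eq_bigr => i _ do rewrite /= mulrBr scalerBl.
rewrite sumrB /= sub0r mulrN scaleNr addrCA scalerBr !scaler_sumr.
congr (_ + _).
  by apply: eq_bigr => i _; rewrite -scalerAl -exprSr scalerA.
rewrite -opprD; congr (- _).
rewrite [in RHS]big_ord_recr /= (@qr_whitney1_gt _ _ _ _ n (bump 0 n)) //
  !mulr0 scale0r addr0.
rewrite [in LHS]big_ord_recl /=; congr (_ + _).
  by rewrite !scalerA -mulrA.
by apply: eq_bigr => i _; rewrite !scalerA -mulrA.
Qed.

Section Uniqueness.
Variables (F : fieldType) (n : nat).

Let J : 'M[F]_n.+1 := \matrix_(i, j) (i == j.+1 :> nat)%:R.

Lemma shift_mxX (k : nat) (i : 'I_n.+1) :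
  (J ^+ k) i ord0 = (i == k :> nat)%:R.
Proof.
elim: k i => [|k IHk] i; first by rewrite expr0 mxE.
rewrite exprS mxE; under eq_bigr do rewrite mxE IHk.
have [ltkn|lenk] := ltnP k n.+1.
  rewrite (bigD1 (Ordinal ltkn)) //= eqxx mulr1 big1 ?addr0 // => j.
  by rewrite -val_eqE /= => /negPf->; rewrite mulr0.
rewrite big1 => [|j _];
  first by rewrite ltn_eqF // ltnS ltnW // (leq_trans _ lenk).
by rewrite [_ == k]ltn_eqF ?mulr0 // (leq_trans _ lenk).
Qed.

Lemma shift_mx_eq0 (p : {poly F}) :
  (size p <= n.+1)%N -> horner_mx J p = 0 -> p = 0.
Proof.
move=> szp pJ0; apply/polyP => k; rewrite coef0.
have [ltkn|lenk] := ltnP k n.+1; last by rewrite nth_default ?(leq_trans szp).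
have [ltkp|lepk] := ltnP k (size p); last by rewrite nth_default.
have <- : horner_mx J p (Ordinal ltkn) ord0 = p`_k; last by rewrite pJ0 mxE.
rewrite -{1}[p]coefK poly_def rmorph_sum summxE /=.
under eq_bigr => i _ do
  rewrite linearZ /= rmorphXn /= horner_mx_X mxE shift_mxX /=.
rewrite (bigD1 (Ordinal ltkp)) //= eqxx mulr1 big1 ?addr0 // => j.
by rewrite -val_eqE /= eq_sym => /negPf->; rewrite mulr0.
Qed.

(* A q-boson pair of matrices whose number operator ad * a is a scalar plus a
   full nilpotent Jordan block, available for every q other than 0 and 1. *)
Lemma qboson_mx (q : F) : q != 0 -> q != 1 ->
  exists a ad : 'M[F]_n.+1,
    qboson q a ad /\ ad * a = (1 - q)^-1 *: 1 + J.
Proof.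
move=> q0 q1; have q10 : 1 - q != 0 by rewrite subr_eq0 eq_sym.
pose x := (1 - q)^-1.
pose D : 'M[F]_n.+1 := diag_mx (\row_j q ^+ j).
pose E : 'M[F]_n.+1 := diag_mx (\row_j q ^- j).
have DE : D * E = 1.
  apply/matrixP => i j; rewrite -[D * E]/(D *m E) mul_diag_mx !mxE.
  by have [->|] := eqVneq i j; rewrite ?mulr0n ?mulr0 // divff ?expf_neq0.
have ED : E * D = 1 by apply: mulmx1C.
have DJ : D * J = q *: (J * D).
  apply/matrixP => i j.
  rewrite -[D * J]/(D *m J) -[J * D]/(J *m D) mul_diag_mx mul_mx_diag !mxE.
  have [->|_] := eqVneq (i : nat) j.+1; last by rewrite mulr0 mul0r mulr0.
  by rewrite exprS mulr1 mul1r.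
exists D, ((x *: 1 + J) * E); split; last by rewrite -mulrA ED mulr1.
rewrite /qboson -mulrA ED mulr1 mulrA mulrDr -scalerAr mulr1 DJ.
rewrite mulrDl -!scalerAl -mulrA DE mulr1 scalerDr opprD addrACA subrr addr0.
by rewrite scalerA -scalerBl -{1}[x]mul1r -mulrBl divff ?scale1r.
Qed.

Lemma normal_order_coefs_uniq (q m r : F) (c d : nat -> F) :
  q != 0 -> q != 1 -> m != 0 ->
  normal_order_coefs q m r n c -> normal_order_coefs q m r n d ->
  forall k : nat, (k <= n)%N -> c k = d k.
Proof.
move=> q0 q1 m0 nc nd k lekn; have [a [ad [qb Nad]]] := qboson_mx q0 q1.
pose p := \poly_(i < n.+1) (c i - d i).
pose b := m / (1 - q) + r; pose l := m *: 'X + b%:P.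
have szl : size l = 2%N.
  by rewrite /l size_polyDl size_scale ?size_polyX //
    (leq_ltn_trans (size_polyC_leq1 _)).
suff p0 : p = 0.
  have : p`_k = c k - d k by rewrite coef_poly ltnS lekn.
  by rewrite p0 coef0 => /esym/subr0_eq.
apply/eqP; rewrite -(comp_poly2_eq0 _ szl); apply/eqP/shift_mx_eq0.
  have [->|pn0] := eqVneq p 0; first by rewrite comp_poly0 size_poly0.
  by rewrite size_comp_poly2 ?size_poly // szl.
have lJ : horner_mx J l = m *: (ad * a) + r%:A.
  rewrite /l rmorphD /= linearZ /= horner_mx_X horner_mx_C Nad scalerDr scalerA.
  rewrite -[b%:M]scalemx1 -[1%:M]/(1 : 'M_n.+1) /b scalerDl addrC.
  by rewrite addrAC.
rewrite /comp_poly /= /p poly_def; set G := _.[_].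
have -> : G = \sum_(i < n.+1) (c i - d i) *: l ^+ i.
  rewrite /G rmorph_sum /= horner_sum; apply: eq_bigr => i _.
  by rewrite map_polyZ /= map_polyXn hornerZ hornerXn mul_polyC.
rewrite rmorph_sum /=.
under eq_bigr => i _ do rewrite linearZ /= rmorphXn /= lJ scalerBl.
by rewrite sumrB -nc // -nd // subrr.
Qed.

End Uniqueness.

Lemma normal_order_coefsP (F : fieldType) (q m r : F) (n : nat) (c : nat -> F) :
  q != 0 -> q != 1 -> m != 0 ->
  normal_order_coefs q m r n c <->
  (forall k : nat, (k <= n)%N -> c k = qr_whitney1 q m r n k).
Proof.
move=> q0 q1 m0; split=> [nc|cE].
  exact: normal_order_coefs_uniq nc (qr_whitney1_normal_order _ _ _ q0 q1).
move=> A a ad qb; rewrite (qr_whitney1_normal_order m r n q0 q1 qb).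
by apply: eq_bigr => k _; rewrite cE // -ltnS.
Qed.

(* Main.v *)
Require Import Defs.
From mathcomp Require Import all_boot all_order all_algebra.
From mathcomp Require Import complex reals.
From mathcomp Require Import ring.

(* Unfolding the recurrence gives
     \sum_k w(n, k) X^k = q^(-'C(n, 2)) \prod_(i < n) (X - (r + [i]_q m)),
   so w(n, k) is, up to sign, an elementary symmetric function of the roots;
   its monomials are indexed by the (n - k)-subsets of 'I_n, that is, by the
   increasing (n - k)-tuples. *)

Import GRing.Theory.
Local Open Scope ring_scope.

(** Each subset has exactly one increasing listing, [enum A]; it is a [d]-tuple only when [A] has
    [d] elements, hence the partial inverse [insub]. *)
Lemma sum_sorted_tuple (V : nmodType) (n d : nat) (G : {set 'I_n} -> V) :
  \sum_(i : d.-tuple 'I_n | sorted ltn [seq val x | x <- i]) G [set x in i]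
    = \sum_(A : {set 'I_n} | #|A| == d) G A.
Proof.
have enum_ltn (A : {set 'I_n}) : sorted ltn [seq val x | x <- enum A].
  rewrite sorted_map {1}/enum_mem; apply: sorted_filter.
    by move=> x y z; apply: ltn_trans.
  by rewrite -sorted_map -enumT val_enum_ord iota_ltn_sorted.
rewrite [RHS](reindex_omap (fun i : d.-tuple 'I_n => [set x in i])
  (fun A => insub (enum A))) => [|A /eqP cA].
  apply: eq_bigl => i; case: insubP => [t _ tE|nsz] /=.
    rewrite (inj_eq Some_inj) -val_eqE /= tE -tE cardE -tE size_tuple eqxx /=.
    apply/idP/eqP => [si|<-]; last by rewrite tE.
    (* Strictly increasing sequences with the same elements coincide. *)
    apply: (inj_map val_inj).
    apply: (irr_sorted_eq ltn_trans ltnn) => // [|x]; first by rewrite tE.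
    by rewrite tE; apply/mapP/mapP => -[y yi ->]; exists y => //;
      move: yi; rewrite mem_enum inE.
  (* Only a tuple with a repeated entry has a support of size other than [d]. *)
  rewrite andbF; apply: contraNF nsz => si.
  rewrite -cardE cardsE (card_uniqP _) ?size_tuple //.
  by rewrite -(map_inj_uniq val_inj) (sorted_uniq ltn_trans ltnn).
case: insubP => [t _ tE|]; last by rewrite -cardE cA eqxx.
by congr Some; apply/setP => x; rewrite /= inE -[x \in t]/(x \in val t) tE mem_enum.
Qed.

Lemma coef_prod_XsubC_set (R : comNzRingType) (n k : nat) (f : 'I_n -> R) :
  (k <= n)%N ->
  (\prod_(i < n) ('X - (f i)%:P))`_k
    = (-1) ^+ (n - k) * \sum_(A : {set 'I_n} | #|A| == (n - k)%N) \prod_(i in A) f i.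
Proof.
(* With the constants put first, [A] collects the factors that contribute [- f i]; the others
   contribute ['X]. *)
move=> lekn; under eq_bigr do rewrite addrC.
rewrite bigA_distr coef_sum mulr_sumr [RHS]big_mkcond /=.
apply: eq_bigr => A _.
have cA : (#|A| + #|[predC A]|)%N = n by rewrite cardC card_ord.
rewrite big_if /= prodr_const.
under eq_bigr do rewrite -rmorphN.
rewrite -rmorph_prod prodrN /= coefCM coefXn.
have -> : (k == #|[predC A]|) = (#|A| == (n - k)%N).
  by rewrite -[RHS](eqn_add2r k) subnK // -[X in _ = (_ == X)]cA eqn_add2l.
by have [->|_] := eqVneq; rewrite ?mulr1 ?mulr0.
Qed.

Lemma qr_whitney1_coef (F : fieldType) (q m r : F) (n k : nat) :
  qr_whitney1 q m r n k
    = q ^- 'C(n, 2) * (\prod_(i < n) ('X - (r + qint q i * m)%:P))`_k.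
Proof.
elim: n k => [|n IHn] k; first by rewrite /= big_ord0 coef1 expr0 invr1 mul1r.
(* Pascal's rule ['C(n.+1, 2) = 'C(n, 2) + n] supplies the factor [q ^- n] of the recurrence. *)
rewrite big_ord_recr /= [_ * ('X - _)]mulrBr coefB coefMX coefMC binS bin1 exprD invfM.
by case: k => [|k]; rewrite /= !IHn; ring.
Qed.

Theorem theorem1 (R : realType) (q m r : R[i]) (n k : nat) :
  q != 0 -> q != 1 -> (k <= n)%N ->
  qr_whitney1 q m r n k
  = (-1) ^+ (n - k) * q ^- 'C(n, 2)
    * \sum_(i : (n - k).-tuple 'I_n | sorted ltn [seq val x | x <- i])
        \prod_(j < n - k) (r + qint q (tnth i j) * m).
Proof.
move=> _ _ lekn.
rewrite qr_whitney1_coef coef_prod_XsubC_set // -sum_sorted_tuple mulrCA mulrA.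
congr (_ * _); apply: eq_bigr => i si.
(* The product over positions becomes one over the support, as an increasing tuple has no
   repetition. *)
rewrite -[RHS](big_tuple _ _ i xpredT (fun x : 'I_n => r + qint q x * m)).
rewrite big_uniq /=; first by apply: eq_bigl => x; rewrite inE.
by rewrite -(map_inj_uniq val_inj) (sorted_uniq ltn_trans ltnn).
Qed.
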